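(* If $\operatorname{cof}(\mathcal{M})=\omega_1$, then the Cantor cube $2^{\omega_1}$ has a countable dense subspace which is not $NWD$-separable. Consequently $\mathfrak{cds}=\omega_1$.
   Context: $\operatorname{cof}(\mathcal{M})$ is the cofinality of the ideal of meager subsets of the real line. A space $X$ is $NWD$-separable if for every sequence $\{D_n:n<\omega\}$ of dense subsets of $X$ there are nowhere dense sets $E_n\subseteq D_n$ with $\bigcup_{n<\omega}E_n$ dense; it is $D$-separable if the same holds with discrete sets $E_n$. $\mathfrak{cds}=\min\{\kappa:2^\kappa\text{ contains a countable non-}D\text{-separable subspace}\}$. *)

(* Defs.v *)
From HB Require Import structures.
From mathcomp Require Import all_boot all_order all_algebra.
From mathcomp Require Import all_classical all_reals all_analysis.
Set Implicit Arguments. Unset Strict Implicit. Unset Printing Implicit Defensive.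
Local Open Scope classical_set_scope.

Definition nowhere_dense {T : topologicalType} (A : set T) : Prop :=
  interior (closure A) = set0.

Definition meager {T : topologicalType} (A : set T) : Prop :=
  exists N : nat -> set T, (forall n, nowhere_dense (N n)) /\ A `<=` \bigcup_n N n.

Definition meager_cofinal {T : topologicalType} (F : set (set T)) : Prop :=
  (forall A, F A -> meager A) /\ (forall M, meager M -> exists2 A, F A & M `<=` A).

Definition cof_meager_is {T : topologicalType} (W : Type) : Prop :=
  (exists F : set (set T), meager_cofinal F /\ (F #= [set: W])%card) /\
  (forall F : set (set T), meager_cofinal F -> ([set: W] #<= F)%card).

Definition is_omega1 (W : Type) (lt : W -> W -> Prop) : Prop :=
  [/\ well_founded lt,
      (forall x y z, lt x y -> lt y z -> lt x z),
      (forall x y, lt x y \/ x = y \/ lt y x),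
      ~ countable [set: W] &
      (forall w, countable [set v | lt v w])].

Definition cantor_cube (K : Type) := prod_topology (fun _ : K => bool).

Definition discrete_subset {T : topologicalType} (E : set T) : Prop :=
  forall x, E x -> exists U : set T, open U /\ U `&` E = [set x].

Definition NWD_separable (T : topologicalType) : Prop :=
  forall D : nat -> set T, (forall n, dense (D n)) ->
  exists E : nat -> set T,
    (forall n, E n `<=` D n /\ nowhere_dense (E n)) /\ dense (\bigcup_n E n).

Definition D_separable (T : topologicalType) : Prop :=
  forall D : nat -> set T, (forall n, dense (D n)) ->
  exists E : nat -> set T,
    (forall n, E n `<=` D n /\ discrete_subset (E n)) /\ dense (\bigcup_n E n).

Definition cube_has_countable_nonDsep (K : Type) : Prop :=
  exists X : set (cantor_cube K), countable X /\ ~ D_separable (set_type X).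

Definition cds_is (K : Type) : Prop :=
  cube_has_countable_nonDsep K /\
  (forall K' : Type, ([set: K'] #<= [set: K])%card -> ~ ([set: K] #<= [set: K'])%card -> ~ cube_has_countable_nonDsep K').

(* Main.v *)
Require Import Defs.
From HB Require Import structures.
From mathcomp Require Import all_boot all_order all_algebra.
From mathcomp Require Import all_classical all_reals all_analysis.
From mathcomp Require Import ring lra.
Import numFieldTopology.Exports.
Import Order.TTheory GRing.Theory Num.Theory.

(* A countable family of columns is indexed by [nat * nat]; its image [X] in
   [2^W] is built one coordinate at a time, every column staying dense.  A
   sequence of nowhere dense sets [E n] is already nowhere dense for the first
   [b] coordinates, [b] countable, and is there described by a strategy: a map
   extending every condition to one avoiding [E n].  If omega_1 strategies
   suffice for all such sequences, then at stage [a] the countably many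
   strategies indexed below [a] can be diagonalised against: the set
   [x a = true] misses, in column [n], the nowhere dense sets given by the first
   [n] of them.  Hence [x a = true], after removing finitely many more nowhere
   dense sets, misses the whole sequence.

   That cof(M) many strategies suffice is a Baire category argument.  The
   interval ]0,1] is identified with the Baire space; a letter is a finite
   attempt at a strategy, and the points all of whose letters are wrong form a
   nowhere dense set.  If it is covered by nowhere dense sets [N k], then below
   some word with only wrong letters it is covered by a single [N k], so any
   extension of that word to a box missing [N k] contains a right letter.  As
   later letters only extend what earlier ones answered, running through the
   whole extension gives a correct answer depending on [N k] and the word only. *)

Set Implicit Arguments. Unset Strict Implicit. Unset Printing Implicit Defensive.
Local Open Scope classical_set_scope.

(** * Topology of subspaces of Cantor cubes *)

Lemma nowhere_denseP (T : topologicalType) (A : set T) :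
  nowhere_dense A <->
  (forall O, open O -> O !=set0 ->
     exists Q, [/\ open Q, Q !=set0, Q `<=` O & Q `&` A = set0]).
Proof.
split=> [nA O oO [x Ox]|H].
- exists (O `&` ~` closure A); split.
  + by apply: openI => //; rewrite openC; exact: closed_closure.
  + apply: contrapT => /set0P/negP; rewrite negbK => /eqP e.
    have : interior (closure A) x.
      apply: (interiorS (A := O)); last by rewrite -(iffLR (interior_id _) oO) in Ox.
      by move=> y Oy; apply: contrapT => ncy; have : set0 y by rewrite -e.
    by rewrite nA.
  + by move=> y [].
  + by rewrite -subset0 => y [[_ nc] Ay]; apply: nc; exact: subset_closure.
- rewrite /nowhere_dense -subset0 => x ix.
  have [Q [oQ [y Qy] sQ dQ]] := H _ (open_interior _) (ex_intro _ x ix).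
  have [|z [Az Qz]] := interior_subset (sQ _ Qy) Q.
    exact: open_nbhs_nbhs.
  by have : set0 z by rewrite -dQ.
Qed.

Lemma In_cat (K : Type) (k : K) (s t : seq K) :
  List.In k (s ++ t) <-> List.In k s \/ List.In k t.
Proof. by elim: s => [|j s IH] /=; [tauto|rewrite IH; tauto]. Qed.

Definition agree (K : Type) (s : list K) (x y : K -> bool) :=
  forall k, List.In k s -> x k = y k.

Lemma agree_app (K : Type) (s t : list K) (x y : K -> bool) :
  agree (s ++ t) x y <-> agree s x y /\ agree t x y.
Proof.
split=> [H|[Hs Ht] k /In_cat[/Hs|/Ht] //].
by split=> k ks; apply: H; apply/In_cat; [left|right].
Qed.

Lemma open_agree_cube (K : Type) (s : list K) (y : K -> bool) :
  open [set x : cantor_cube K | agree s x y].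
Proof.
elim: s => [|k s IH].
  have -> : [set x : cantor_cube K | agree [::] x y] = setT.
    by apply/seteqP; split=> // x _ k [].
  exact: openT.
have -> : [set x : cantor_cube K | agree (k :: s) x y] =
    [set x : cantor_cube K | x k = y k] `&` [set x : cantor_cube K | agree s x y].
  rewrite predeqE => x; split => [H|[/= H1 H2] j [<-|js]] //; last exact: H2.
  by split=> [|j js]; apply: H; [left|right].
apply: openI => //; rewrite openE => x /= xk.
have /cvg_sup/(_ k) : nbhs x --> x by exact: cvg_id.
apply; exists [set z | z k = y k]; split=> //.
by exists [set y k] => //; exact: discrete_open.
Qed.

Lemma open_cube_agree (K : Type) (O : set (cantor_cube K)) (x : cantor_cube K) :
  open O -> O x -> exists s, forall z : cantor_cube K, agree s z x -> O z.
Proof.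
move=> oO Ox.
pose F : set_system (cantor_cube K) :=
  [set A | exists s, forall z : cantor_cube K, agree s z x -> A z].
have FF : Filter F.
  split=> [|A B [s As] [t Bt]|A B AB [s As]].
  - by exists [::].
  - by exists (s ++ t) => z /agree_app[/As Az /Bt Bz].
  - by exists s => z /As/AB.
suff : F --> x by apply; exact: open_nbhs_nbhs.
apply/cvg_sup => k A [_ [[B oB <-] /= Bx] BA].
by exists [:: k] => z zx; apply: BA => /=; rewrite zx //; left.
Qed.

Lemma open_agree (K : Type) (X : set (cantor_cube K)) (s : list K) (y : K -> bool) :
  open [set x : set_type X | agree s (val x) y].
Proof. by exists [set x : cantor_cube K | agree s x y] => //; exact: open_agree_cube. Qed.

Lemma open_subspace_agree (K : Type) (X : set (cantor_cube K))
    (O : set (set_type X)) (x : set_type X) :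
  open O -> O x -> exists s, forall z : set_type X, agree s (val z) (val x) -> O z.
Proof.
move=> [U oU <-] /= Ux.
have [s Hs] := open_cube_agree oU Ux.
by exists s => z az; exact: Hs.
Qed.

(** * ]0,1] as the Baire space *)

Section Boxes.
Local Open Scope ring_scope.
Context {R : realType}.
Implicit Types (p : R * R) (h t : seq nat) (x : R) (n m : nat).

(* The intervals ]a + (b-a)/(n+2), a + (b-a)/(n+1)] partition ]a, b] and have
   their closures inside it, so that nested boxes have a common point. *)
Definition box_step p n : R * R :=
  (p.1 + (p.2 - p.1) / n.+2%:R, p.1 + (p.2 - p.1) / n.+1%:R).

Definition in_box p : set R := [set x | p.1 < x /\ x <= p.2].

Lemma box_stepP p n : p.1 < p.2 ->
  [/\ p.1 < (box_step p n).1, (box_step p n).1 < (box_step p n).2,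
      (box_step p n).2 <= p.2 &
      (box_step p n).2 - (box_step p n).1 <= (p.2 - p.1) / 2].
Proof.
case: p => a b /= ab; have d0 : 0 < b - a by rewrite subr_gt0.
have n1 : (1 : R) <= n.+1%:R by rewrite ler1n.
have n2 : n.+2%:R = n.+1%:R + 1 :> R by rewrite -natr1.
have n1i : n.+1%:R^-1 <= (1 : R) by rewrite invf_le1 // ltr0Sn.
split.
- by rewrite ltrDl divr_gt0 // ltr0Sn.
- by rewrite ltrD2l ltr_pM2l // ltf_pV2 ?posrE ?ltr0Sn // ltr_nat.
- by rewrite -lerBrDl ler_piMr // ltW.
- rewrite opprD addrACA subrr add0r -mulrBr ler_wpM2l ?(ltW d0) // n2.
  have -> : n.+1%:R^-1 - (n.+1%:R + 1)^-1 = (n.+1%:R * (n.+1%:R + 1))^-1 :> R.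
    by field; lra.
  by rewrite lef_pV2 ?posrE; nra.
Qed.

Lemma in_box_step p n : p.1 < p.2 -> in_box (box_step p n) `<=` in_box p.
Proof.
by move=> /(box_stepP n)[h1 h2 h3 _] x [/= x1 x2]; split;
  [apply: lt_trans x1|apply: le_trans h3].
Qed.

Lemma in_box_cover p x : in_box p x -> exists n, in_box (box_step p n) x.
Proof.
case: p => a b [/= ax xb].
have xa : 0 < x - a by rewrite subr_gt0.
have u1 : 1 <= (b - a) / (x - a) by rewrite ler_pdivlMr // mul1r lerD2r.
have /andP[l1 l2] := truncn_itv (le_trans ler01 u1).
(* With [n.+1] the integer part of [(b - a) / (x - a)], its two bounds say that [x] lies in the
   [n]th step; the quotient is at least 1, so the value 0 is excluded. *)
move: l1 l2; case: Num.truncn => [_ /(le_lt_trans u1)|n l1 l2]; first by rewrite ltxx.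
exists n; rewrite /in_box /box_step /=; split.
- by rewrite -ltrBrDl ltr_pdivrMr ?ltr0Sn // mulrC -ltr_pdivrMr.
- by rewrite -lerBlDl ler_pdivlMr ?ltr0Sn // mulrC -ler_pdivlMr.
Qed.

Lemma in_box_inj p x n m : p.1 < p.2 ->
  in_box (box_step p n) x -> in_box (box_step p m) x -> n = m.
Proof.
move=> pp; wlog nm : n m / (n < m)%N => [H xn xm|].
  by case: (ltngtP n m) => // [nm|mn]; [exact: H|apply/esym; exact: H].
move=> [/= xn _] [_ /= xm]; have := lt_le_trans xn xm.
rewrite ltrD2l ltr_pM2l ?subr_gt0 // ltf_pV2 ?posrE ?ltr0Sn // ltr_nat.
by rewrite !ltnS leqNgt nm.
Qed.

Definition ends h : R * R := foldl box_step (0, 1) h.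
Definition box h := in_box (ends h).

Lemma ends_rcons h n : ends (rcons h n) = box_step (ends h) n.
Proof. by rewrite /ends -cats1 foldl_cat. Qed.

Lemma ends_lt h : (ends h).1 < (ends h).2.
Proof.
elim/last_ind: h => [|h n IH]; first exact: ltr01.
by rewrite ends_rcons; have [] := box_stepP n IH.
Qed.

Lemma ends_small h : (ends h).2 - (ends h).1 <= 2^-1 ^+ size h.
Proof.
elim/last_ind: h => [|h n IH]; first by rewrite /= subr0 expr0.
rewrite ends_rcons size_rcons exprS.
have [_ _ _] := box_stepP n (ends_lt h).
by move/le_trans; apply; rewrite mulrC ler_wpM2l // invr_ge0.
Qed.

Lemma box_cat h t : box (h ++ t) `<=` box h.
Proof.
elim/last_ind: t => [|t n IH]; first by rewrite cats0.
rewrite -rcons_cat /box ends_rcons.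
by apply: subset_trans IH; apply: in_box_step; exact: ends_lt.
Qed.

Lemma box_prefix h t x : box h x -> box t x -> (size h <= size t)%N ->
  h = take (size h) t.
Proof.
elim/last_ind: t h => [|t m IH] h xh xt.
  by rewrite leqn0 size_eq0 => /eqP ->.
rewrite leq_eqVlt => /predU1P[e|]; last first.
  rewrite size_rcons ltnS => ht; rewrite -cats1 takel_cat //; apply: IH => //.
  by apply: (box_cat (t := [:: m])); rewrite cats1.
rewrite e take_size; move: xh e; case/lastP: h => [_|h n xh].
  by rewrite size_rcons.
rewrite !size_rcons => -[e].
have bh : box h x by apply: (box_cat (t := [:: n])); rewrite cats1.
have bt : box t x by apply: (box_cat (t := [:: m])); rewrite cats1.
have := IH h bh bt; rewrite e leqnn take_size => /(_ isT) ht.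
rewrite ht in xh; move: xh xt; rewrite /box !ends_rcons => xh xt.
by rewrite ht (in_box_inj (ends_lt t) xh xt).
Qed.

Lemma box_branch h x k : box h x -> exists2 t, size t = k & box (h ++ t) x.
Proof.
elim: k h => [|k IH] h xh; first by exists [::]; rewrite ?cats0.
have [n xn] := in_box_cover xh.
rewrite -ends_rcons in xn; have [t st xt] := IH _ xn.
by exists (n :: t); rewrite /= ?st // -cat_rcons.
Qed.

Lemma box_sub_open h x (V : set R) : open V -> box h x -> V x ->
  exists t, box (h ++ t) `<=` V.
Proof.
move=> oV xh Vx.
have /nbhs_ballP[e /= e0 eV] : nbhs x V by exact: open_nbhs_nbhs.
have [k ke] : exists k, 2^-1 ^+ k < e.
  exists (Num.truncn e^-1).+1; rewrite exprVn invf_plt ?posrE ?exprn_gt0 //.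
  have e1 : 0 <= e^-1 by rewrite invr_ge0 ltW.
  have /andP[_] := truncn_itv e1.
  by move/lt_le_trans; apply; rewrite -natrX ler_nat ltnW // ltn_expl.
have [t st xt] := box_branch k xh.
exists t => y yt; apply: eV; rewrite /ball /= distrC ltr_distlC.
have sm : (ends (h ++ t)).2 - (ends (h ++ t)).1 < e.
  apply: le_lt_trans (ends_small _) _; apply: le_lt_trans ke.
  rewrite size_cat st exprD ler_piMl ?exprn_ge0 ?exprn_ile1 ?invr_ge0 //.
  by rewrite invf_le1 // ler1n.
by move: xt yt => [x1 x2] [y1 y2]; lra.
Qed.

Lemma box_interior h : exists2 V : set R, open V & V !=set0 /\ V `<=` box h.
Proof.
have hh := ends_lt h.
exists [set` `](ends h).1, (ends h).2[]; first exact: interval_open.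
split=> [|y /=]; last by rewrite in_itv /= => /andP[y1 y2]; split; last exact: ltW.
exists (((ends h).1 + (ends h).2) / 2) => /=; rewrite in_itv /=.
by apply/andP; split; lra.
Qed.

Lemma box_avoid h (N : set R) : nowhere_dense N ->
  exists t, box (h ++ t) `&` N = set0.
Proof.
move=> /nowhere_denseP nN; have [V oV [V0 Vh]] := box_interior h.
have [Q [oQ [x Qx] QV QN]] := nN _ oV V0.
have [t tQ] := box_sub_open oQ (Vh _ (QV _ Qx)) Qx.
by exists t; rewrite -subset0 => y [/tQ Qy Ny]; rewrite -QN.
Qed.

Lemma box_limit (H : nat -> seq nat) (T : nat -> seq nat) :
  (forall k, H k.+1 = H k ++ T k /\ T k != [::]) -> exists x, forall k, box (H k) x.
Proof.
move=> HT.
have strict h t : t != [::] -> (ends h).1 < (ends (h ++ t)).1.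
  elim/last_ind: t => // t n IH _; rewrite -rcons_cat ends_rcons.
  have [lt1 _ _ _] := box_stepP n (ends_lt (h ++ t)).
  case: (eqVneq t [::]) lt1 => [->|t0]; first by rewrite cats0.
  by apply: lt_trans; exact: IH.
have mono2 h t : (ends (h ++ t)).2 <= (ends h).2.
  elim/last_ind: t => [|t n IH]; first by rewrite cats0.
  rewrite -rcons_cat ends_rcons.
  by have [_ _ l2 _] := box_stepP n (ends_lt (h ++ t)); exact: le_trans IH.
have Hadd k j : exists t, H (k + j)%N = H k ++ t.
  elim: j => [|j [t IH]]; first by exists [::]; rewrite addn0 cats0.
  by exists (t ++ T (k + j)%N); rewrite addnS (HT _).1 IH catA.
have incr k : (ends (H k)).1 < (ends (H k.+1)).1.
  by have [-> ?] := HT k; exact: strict.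
have bound k j : (ends (H k)).1 <= (ends (H j)).2.
  have [kj|/ltnW jk] := leqP k j.
  - have [t e] := Hadd k (j - k)%N; rewrite subnKC // in e.
    apply: le_trans (ltW (ends_lt (H j))).
    by rewrite e; case: t {e} => [|n t]; [rewrite cats0|rewrite ltW // strict].
  - have [t e] := Hadd j (k - j)%N; rewrite subnKC // in e.
    by apply: le_trans (ltW (ends_lt (H k))) _; rewrite e mono2.
(* The common point is the supremum of the left ends: they increase strictly because each [T k] is
   nonempty, which secures the open left end, and they stay below every right end. *)
pose A : set R := [set (ends (H k)).1 | k in setT].
have A0 : A !=set0 by exists (ends (H 0%N)).1, 0%N.
have hA : has_ubound A by exists (ends (H 0%N)).2 => _ [k _ <-]; exact: bound.
exists (sup A) => k; split.
- apply: lt_le_trans (incr k) _; apply: ub_le_sup => //.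
  by exists k.+1.
- by apply: ge_sup => // _ [j _ <-]; exact: bound.
Qed.

Lemma box_baire (G : set (seq nat)) :
  (forall h, exists n, G (rcons h n)) ->
  nowhere_dense (box [::] `\` \bigcup_(h in G) box h).
Proof.
move=> HG; apply/nowhere_denseP => O oO O0.
have [[y [Oy [y0 _]]]|no] :=
  pselect (exists y, O y /\ (box [::] `\` \bigcup_(h in G) box h) y); last first.
  exists O; split=> //; rewrite -subset0 => y [Oy My]; apply: no; by exists y.
have [t tO] := box_sub_open oO y0 Oy.
have [n Gn] := HG t.
have [V oV [V0 Vt]] := box_interior (rcons t n).
exists V; split=> // [y' /Vt|].
  by rewrite -cats1 => /box_cat/tO.
by rewrite -subset0 => z [/Vt zt [_]]; apply; exists (rcons t n).
Qed.
End Boxes.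

(** * Strategies avoiding nowhere dense sets *)

Section Strategies.
Implicit Types (h t : seq nat) (D : nat -> set (seq bool)).

(** A number [j] codes a request, to extend a word into [D n]; a letter codes a finite list whose
    [j]th entry is its attempt at request [j]. *)
Definition cond (j : nat) : nat * seq bool := odflt (0, [::]) (unpickle j).
Definition letter (m : nat) : seq (seq bool) := odflt [::] (unpickle m).
Definition blank : nat := pickle ([::] : seq (seq bool)).
Definition answer h (j : nat) : seq bool :=
  flatten [seq nth [::] (letter m) j | m <- h].

(* The length condition makes the empty letter [blank] never good, so a word can
   be prolonged without creating a good prefix. *)
Definition good D : set (seq nat) := [set h |
  size h < size (letter (last blank h)) /\
  forall j, j < size h -> D (cond j).1 ((cond j).2 ++ answer h j)].

Definition bad D h := forall i, i <= size h -> ~ good D (take i h).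

Lemma letter_pickle (a : seq (seq bool)) : letter (pickle a) = a.
Proof. by rewrite /letter pickleK. Qed.

Lemma answer_cat h t j : answer (h ++ t) j = answer h j ++ answer t j.
Proof. by rewrite /answer map_cat flatten_cat. Qed.

Lemma good_extend D : (forall n p, exists w, D n (p ++ w)) ->
  forall h, exists m, good D (rcons h m).
Proof.
move=> dD h.
have /choice[w Hw] : forall j, exists w, D (cond j).1 (((cond j).2 ++ answer h j) ++ w).
  by move=> j; exact: dD.
(* The new word has length [(size h).+1] and [good] wants strictly more entries, whence
   [(size h).+2]. *)
exists (pickle (mkseq w (size h).+2)); split.
  by rewrite last_rcons letter_pickle size_mkseq size_rcons.
move=> j; rewrite size_rcons => jh.
rewrite -cats1 answer_cat catA /answer /= letter_pickle cats0 nth_mkseq; first exact: Hw.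
exact: leqW.
Qed.

Lemma bad_blank D h n : bad D h -> bad D (h ++ nseq n blank).
Proof.
move=> bh i ih; have [le|lt] := leqP i (size h).
  by rewrite takel_cat //; exact: bh.
move=> [+ _]; rewrite take_cat (ltnNge i) (ltnW lt) /= last_cat.
have -> : last (last blank h) (take (i - size h) (nseq n blank)) = blank.
  rewrite take_nseq; last by move: ih; rewrite size_cat size_nseq leq_subLR.
  have : 0 < i - size h by rewrite subn_gt0.
  by case: (i - size h) => // k _ /=; elim: k => //.
by rewrite letter_pickle.
Qed.

Context {R : realType}.

(** Otherwise bad words [H k] can be prolonged so that the box of [H (k.+1)] misses [N k]. Their
    common point lies in no [N k], hence in the box of a good word, which is then a prefix of some
    [H k]: a contradiction. *)
Lemma bad_localized D (N : nat -> set R) :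
  box [::] `\` \bigcup_(h in good D) box h `<=` \bigcup_k N k ->
  exists h k, bad D h /\
    forall t, box (h ++ t) `&` N k = set0 -> ~ bad D (h ++ t).
Proof.
move=> MN; apply: contrapT => no.
have next (hk : seq nat * nat) : exists t, bad D hk.1 ->
    [/\ box (hk.1 ++ t) `&` N hk.2 = set0, bad D (hk.1 ++ t) & t != [::]].
  case: hk => h k /=; have [bh|nb] := pselect (bad D h); last by exists [::].
  apply: contrapT => no'; apply: no; exists h, k; split=> // t tN bt.
  (* The extra [blank] preserves badness and keeps the extension nonempty when [t] is empty, as
     [box_limit] requires. *)
  apply: no'; exists (t ++ nseq 1 blank) => _; rewrite catA; split.
  - rewrite -subset0 => x [/box_cat tx Nx].
    by rewrite -tN.
  - exact: bad_blank.
  - by case: t {tN bt}.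
have {next} [T HT] := choice next.
pose H := fix H k := if k is k'.+1 then H k' ++ T (H k', k') else [::].
have Hb k : bad D (H k).
  elim: k => [|k IH] /=; last by have [] := HT (H k, k) IH.
  by case=> // _ [+ _]; rewrite take0 letter_pickle.
have [x xH] : exists x : R, forall k, box (H k) x.
  by apply: (@box_limit _ H (fun k => T (H k, k))) => k; have [] := HT (H k, k) (Hb k).
have sH k : k <= size (H k).
  elim: k => //= k IH; rewrite size_cat; have [_ _] := HT (H k, k) (Hb k).
  rewrite -size_eq0 -lt0n => lt; apply: leq_ltn_trans IH _.
  by rewrite -ltn_subLR ?leqnn // subnn.
have [|k _ Nk] := MN x.
  split; first exact: (xH 0).
  move=> [h Gh xh]; apply: (Hb (size h) (size h)); first exact: sH.
  by rewrite -(box_prefix xh (xH _) (sH _)).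
have [e _ _] := HT (H k, k) (Hb k).
have : set0 x by rewrite -e; split=> //; exact: (xH k.+1).
by [].
Qed.

Lemma strategies_cofinal (W : Type) : @cof_meager_is (R : topologicalType) W ->
  exists r : W -> nat -> nat -> seq bool -> seq bool,
  forall D, (forall n p w, D n p -> D n (p ++ w)) ->
    (forall n p, exists w, D n (p ++ w)) ->
  exists c m, forall n p, D n (p ++ r c m n p).
Proof.
move=> [[F [[Fm Fc] FW]] _].
have /card_set_bijP[A [AF _ sA]] : ([set: W] #= F)%card by rewrite card_eq_sym.
have /choice[N HN] : forall c, exists N : nat -> set R,
    (forall k, nowhere_dense (N k)) /\ A c `<=` \bigcup_k N k.
  by move=> c; apply: Fm; exact: AF.
(* When [h] is bad, so is its padding by [j.+1] blanks; a good prefix of an extension is then longer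
   than [j] and answers request [j]. *)
pose pad (h : seq nat) (j : nat) := h ++ nseq j.+1 blank.
have /choice[T HT] : forall x : W * nat * seq nat * nat, exists t,
    box (pad x.1.2 x.2 ++ t) `&` N x.1.1.1 x.1.1.2 = set0.
  by move=> [[[c k] h] j]; apply: box_avoid; exact: (HN c).1.
pose dec m : nat * seq nat := odflt (0, [::]) (unpickle m).
exists (fun c m n p => let j := pickle (n, p) in
  answer (pad (dec m).2 j ++ T (c, (dec m).1, (dec m).2, j)) j).
move=> D oD dD.
have [c0 Fc0 MA] : exists2 A0, F A0 & (box [::] `\` \bigcup_(h in good D) box h) `<=` A0.
  apply: Fc; exists (fun=> box [::] `\` \bigcup_(h in good D) box h); split.
    by move=> _; apply: box_baire; exact: good_extend.
  by move=> x Mx; exists 0.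
have [c _ eA] := sA _ Fc0; rewrite -{}eA {c0 Fc0} in MA.
have [h [k [bh Hh]]] := bad_localized (subset_trans MA (HN c).2).
exists c, (pickle (k, h)) => n p /=.
rewrite /dec pickleK /=; set j := pickle (n, p); set t := T _.
have := HT (c, k, h, j); rewrite -/t /= => tN.
have : ~ bad D (pad h j ++ t) by rewrite /pad -catA; apply: Hh; rewrite catA.
move=> /existsNP[i] /not_implyP[ih /contrapT Gi].
have ji : j < i.
  have [ip|] := leqP i (size (pad h j)).
    case: (bad_blank (n := j.+1) bh ip); rewrite -/(pad h j).
    by move: Gi; rewrite takel_cat.
  by apply: leq_trans; rewrite ltnS size_cat size_nseq addnS leqW // leq_addl.
have /(_ j) := Gi.2; rewrite size_takel // => /(_ ji).
rewrite /cond /j pickleK -/j /= => Dn.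
by rewrite -(cat_take_drop i (pad h j ++ t)) answer_cat catA; exact: oD.
Qed.
End Strategies.

(** * Construction along omega_1 *)

(** The tasks [(t, b, N)] are enumerated and served at strictly increasing indices [a k]; no index
    serves two tasks, so [f] can be prescribed at each. *)
Lemma split_infinite (S : nat -> set nat) :
  (forall t N, exists i, N <= i /\ S t i) ->
  exists f : nat -> bool, forall t b N, exists i, [/\ N <= i, S t i & f i = b].
Proof.
move=> S_unbounded.
have /choice[g Hg] : forall tN : nat * nat, exists i, tN.2 <= i /\ S tN.1 i.
  by move=> [t N]; exact: S_unbounded.
pose task k : nat * bool * nat := odflt (0, true, 0) (unpickle k).
pose a := fix a k := g ((task k).1.1, maxn (task k).2 (if k is j.+1 then (a j).+1 else 0)).
have aP k : (task k).2 <= a k /\ S (task k).1.1 (a k).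
  have [e Sa] : exists e, maxn (task k).2 e <= a k /\ S (task k).1.1 (a k).
    case: k => [|k]; [exists 0|exists (a k).+1].
      exact: (Hg ((task 0).1.1, maxn (task 0).2 0)).
    exact: (Hg ((task k.+1).1.1, maxn (task k.+1).2 (a k).+1)).
  by split; [exact: leq_trans (leq_maxl _ _) Sa.1|exact: Sa.2].
have a_lt j k : j < k -> a j < a k.
  elim: k => // k IH; have step : a k < a k.+1.
    have [/= le_max _] := Hg ((task k.+1).1.1, maxn (task k.+1).2 (a k).+1).
    exact: leq_trans (leq_maxr _ _) le_max.
  by rewrite ltnS leq_eqVlt => /predU1P[->//|/IH /ltn_trans]; exact.
have a_inj j k : a j = a k -> j = k.
  by case: (ltngtP j k) => // /a_lt + e; rewrite e ltnn.
exists (fun i => `[< exists2 k, a k = i & (task k).1.2 >]) => t b N.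
have taskE : task (pickle (t, b, N)) = (t, b, N) by rewrite /task pickleK.
have [aN aS] := aP (pickle (t, b, N)); rewrite taskE /= in aN aS.
exists (a (pickle (t, b, N))); split=> //.
case: b taskE {aN aS} => taskE; [apply/asboolP|apply/asboolPn].
  by exists (pickle (t, true, N)); rewrite ?taskE.
by move=> [k /a_inj ->]; rewrite taskE.
Qed.

Lemma countable_setU (T : Type) (A B : set T) :
  countable A -> countable B -> countable (A `|` B).
Proof.
move=> cA cB; rewrite -bigcup2E; apply: bigcup_countable => // i _.
by rewrite /bigcup2; case: ifP => // _; case: ifP.
Qed.

Lemma In_finite (T : Type) (s : seq T) : finite_set [set v | List.In v s].
Proof.
elim: s => [|v s IH].
  have -> : [set v : T | List.In v [::]] = set0 by apply/seteqP; split.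
  exact: finite_set0.
have -> : [set u | List.In u (v :: s)] = [set v] `|` [set u | List.In u s].
  by apply/seteqP; split=> u [->|us]; [left|right|left|right].
by rewrite finite_setU.
Qed.

Lemma In_countable (T : Type) (s : seq T) : countable [set v | List.In v s].
Proof. exact/finite_set_countable/In_finite. Qed.

Section Omega1.
Context {W : Type} {lt : W -> W -> Prop} (HW : is_omega1 lt).
Implicit Types (a b c u v : W) (s : seq W) (x y : W -> bool) (p w : seq bool).

Lemma lt_wf : well_founded lt. Proof. by case: HW. Qed.
Lemma lt_tr a b c : lt a b -> lt b c -> lt a c.
Proof. by case: HW => _ + _ _ _; exact. Qed.
Lemma lt_total a b : lt a b \/ a = b \/ lt b a.
Proof. by case: HW. Qed.

Lemma lt_irr a : ~ lt a a.
Proof. by elim/(well_founded_ind lt_wf): a => a IH aa; exact: (IH a aa). Qed.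

Lemma lt_least (P : set W) : P !=set0 -> exists a, P a /\ forall b, lt b a -> ~ P b.
Proof.
move=> [a Pa]; apply: contrapT => no; move: a Pa.
elim/(well_founded_ind lt_wf) => a IH Pa; apply: no; exists a; split=> //.
Qed.

Lemma countable_bounded (S : set W) : countable S -> exists a, forall v, S v -> lt v a.
Proof.
case: HW => _ _ _ ncW cW cS; apply: contrapT => no; apply: ncW.
suff : countable (\bigcup_(v in S) ([set v] `|` [set u | lt u v])).
  apply: sub_countable; apply: subset_card_le => a _.
  apply: contrapT => na; apply: no; exists a => v Sv.
  by case: (lt_total v a) => // -[e|va]; case: na; exists v => //; [left|right].
by apply: bigcup_countable => // v _; apply: countable_setU => //; exact: countable1.
Qed.

Lemma list_max s : s <> [::] ->
  exists v, List.In v s /\ forall u, List.In u s -> u = v \/ lt u v.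
Proof.
elim: s => // v s IH _; case: s IH => [|v' s] IH.
  by exists v; split; [left|move=> u [->|[]]; left].
have [//|m [ms mm]] := IH.
case: (lt_total v m) => [vm|[e|mv]].
- by exists m; split; [right|move=> u [<-|/mm//]; right].
- by exists m; split; [right|move=> u [<-|/mm//]; left].
- exists v; split; [by left|move=> u [<-|/mm[->|um]]; [by left|by right|right]].
  exact: lt_tr um mv.
Qed.

Lemma below_injection : exists g : W -> W -> nat,
  forall a u v, lt u a -> lt v a -> g a u = g a v -> u = v.
Proof.
have : forall a, exists f : W -> nat, {in [set v | lt v a] &, injective f}.
  by case: HW => _ _ _ _ cW a; exact/countable_injP.
move=> /choice[g Hg]; exists g => a u v ua va; apply: Hg; exact/mem_set.
Qed.

Context (g : W -> W -> nat).
Hypothesis g_inj : forall a u v, lt u a -> lt v a -> g a u = g a v -> u = v.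

(* The basic clopen set of the topology at stage [a] coded by the word [p]: the
   coordinates below [a] are read in the order given by the injection [g a]. *)
Definition cyl a p : set (W -> bool) :=
  [set x | forall v, lt v a -> g a v < size p -> x v = nth false p (g a v)].

Lemma cyl_cat a p w : cyl a (p ++ w) `<=` cyl a p.
Proof.
move=> x xpw v va vp; rewrite xpw ?nth_cat ?vp // size_cat.
exact: leq_trans vp (leq_addr _ _).
Qed.

(** Injectivity of [g a] leaves at most one coordinate per digit, so [cyl a p] depends on finitely
    many coordinates. *)
Lemma cyl_support a M : exists s, (forall v, List.In v s -> lt v a) /\
  (forall v, lt v a -> g a v < M -> List.In v s).
Proof.
elim: M => [|M [s [sa Hs]]]; first by exists [::].
have [[u [ua uM]]|no] := pselect (exists u, lt u a /\ g a u = M).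
- exists (u :: s); split=> [v [<-//|/sa//]|v va].
  rewrite ltnS leq_eqVlt => /predU1P[e|/Hs vs]; [left|right; exact: vs].
  by apply: (g_inj ua va); rewrite uM e.
- exists s; split=> // v va; rewrite ltnS leq_eqVlt => /predU1P[e|/Hs]; last exact.
  by case: no; exists v.
Qed.

Lemma cyl_refine a p s y :
  (forall v, List.In v s -> lt v a -> g a v < size p -> y v = nth false p (g a v)) ->
  exists w, forall x, cyl a (p ++ w) x ->
    forall v, List.In v s -> lt v a -> x v = y v.
Proof.
move=> yp.
have [M HM] : exists M, forall v, List.In v s -> g a v < M.
  elim: s {yp} => [|v s [M HM]]; first by exists 0.
  exists (maxn M (g a v).+1) => u [<-|/HM uM]; first exact: leq_maxr.
  by apply: leq_trans uM _; exact: leq_maxl.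
(* [bit] is [y] transported along [g a]; numbers that are not values of [g a] below [a] get
   [false]. *)
pose bit k := `[< exists v, [/\ lt v a, g a v = k & y v] >].
have bitE v : lt v a -> bit (g a v) = y v.
  move=> va; case e: (y v); [apply/asboolP|apply/asboolPn]; first by exists v.
  by move=> [u [ua /(g_inj ua va) ->]]; rewrite e.
exists (mkseq (fun k => bit (size p + k)) M) => x xpw v vs va.
have vM := HM v vs.
rewrite xpw //; last by rewrite size_cat size_mkseq; apply: leq_trans vM (leq_addl _ _).
rewrite nth_cat; case: ltnP => [vp|pv]; first by rewrite yp.
rewrite nth_mkseq; first by rewrite subnKC // bitE.
by apply: leq_ltn_trans vM; exact: leq_subr.
Qed.

Lemma cyl_code a s y : exists p, forall x, cyl a p x ->
  forall v, List.In v s -> lt v a -> x v = y v.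
Proof. by have [|p Hp] := @cyl_refine a [::] s y; last by exists p. Qed.

(** The hypothesis makes [y] overwritten by [w] consistent with both. This lets a strategy at [b]
    act under a finite condition that may reach beyond [b]. *)
Lemma cyl_merge b w s y :
  (forall x, cyl b w x -> forall v, List.In v s -> lt v b -> x v = y v) ->
  exists s' y', (forall v, List.In v s' -> List.In v s \/ lt v b) /\
    forall x, agree s' x y' -> agree s x y /\ cyl b w x.
Proof.
move=> Hw; have [t [tb Ht]] := cyl_support b (size w).
pose y' v := if `[< lt v b /\ g b v < size w >] then nth false w (g b v) else y v.
have y'w : cyl b w y'.
  by move=> v vb vw; rewrite /y'; case: asboolP => // -[].
have y'y v : List.In v s -> y' v = y v.
  move=> vs; have [vb|nvb] := pselect (lt v b); first exact: Hw.
  by rewrite /y'; case: asboolP => // -[].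
exists (s ++ t), y'; split=> [v /In_cat[vs|/tb vb]|x /agree_app[xs xt]].
- by left.
- by right.
- split=> [v vs|v vb vw]; first by rewrite xs // y'y.
  by rewrite xt ?y'w //; exact: Ht.
Qed.

(** * Stages of the recursion *)

Context (r : W -> nat -> nat -> seq bool -> seq bool).
Implicit Types (phi : W -> nat -> nat -> bool) (f : nat -> nat -> bool).

Definition column_point phi n i : W -> bool := fun v => phi v n i.

(* The strategies available at stage [a] are numbered through [g a]; in column [n]
   only the first [n] of them are obeyed, which are finitely many. *)
Definition obeys phi a n i := forall b c m, lt b a -> lt c a ->
  pickle (g a b, g a c, m) <= n ->
  exists p, cyl b (p ++ r c m n p) (column_point phi n i).

(** Both values of [f] are demanded so that columns stay dense once coordinate [a] is added; the
    bound [N] provides the infinitely many indices that later splittings consume. *)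
Definition stage phi a f :=
  (forall n i, f n i -> obeys phi a n i) /\
  (forall s y, (forall v, List.In v s -> lt v a) ->
     forall n (b : bool) N, exists i, [/\ N <= i, f n i = b & agree s (column_point phi n i) y]).

Definition rich phi a := forall s y, (forall v, List.In v s -> lt v a) ->
  forall n N, exists i, N <= i /\ agree s (column_point phi n i) y.

(** A nonempty finite condition has a largest coordinate [v], and stage [v] realises the part below
    [v] together with either value at [v]. Limit stages thus need no separate argument. *)
Lemma rich_stages phi a : (forall v, lt v a -> stage phi v (phi v)) -> rich phi a.
Proof.
move=> Hphi s y sa n N; have [->|s0] := pselect (s = [::]).
  by exists N; split=> // v [].
have [v [vs vmax]] := list_max s0.
have [t [tv st]] : exists t, (forall u, List.In u t -> lt u v) /\
    (forall u, List.In u s -> u = v \/ List.In u t).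
  elim: s vmax {sa s0 vs} => [|u s IH] vmax; first by exists [::].
  have [|t [tv st]] := IH; first by move=> u' u's; apply: vmax; right.
  have [->|uv] := vmax u (or_introl erefl).
    by exists t; split=> // u' [<-|/st//]; left.
  exists (u :: t); split=> [u' [<-//|/tv//]|u' [<-|/st[->|u't]]].
  - by right; left.
  - by left.
  - by right; right.
have [_ /(_ t y tv n (y v) N)[i [Ni fi ti]]] := Hphi v (sa v vs).
by exists i; split=> // u /st[->|/ti].
Qed.

Lemma obeying_refine phi a n T s y : (forall v, List.In v s -> lt v a) ->
  exists s' y', (forall v, List.In v s' -> lt v a) /\
    forall x, agree s' x y' -> agree s x y /\
      forall b c m, lt b a -> lt c a -> pickle (g a b, g a c, m) < T ->
      exists p, cyl b (p ++ r c m n p) x.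
Proof.
move=> sa; elim: T => [|T [s1 [y1 [s1a H1]]]]; first by exists s, y.
have [[b [c [m [ba ca e]]]]|no] := pselect (exists b c (m : nat),
    [/\ lt b a, lt c a & pickle (g a b, g a c, m) = T]); last first.
  exists s1, y1; split=> // x /H1[xs xT]; split=> // b c m ba ca.
  by rewrite ltnS leq_eqVlt => /predU1P[e|/xT]; [case: no; exists b, c, m|exact].
(* [p] decides the coordinates of [s1] below [b] as [y1] does, so the response [r c m n p] can be
   adjoined without contradicting [y1]. *)
have [p Hp] := cyl_code b s1 y1.
have [|s2 [y2 [s2s H2]]] := @cyl_merge b (p ++ r c m n p) s1 y1.
  by move=> x /cyl_cat; exact: Hp.
exists s2, y2; split=> [v /s2s[/s1a//|vb]|x /H2[/H1[xs xT] xp]].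
  exact: lt_tr vb ba.
split=> // b' c' m' ba' ca'; rewrite ltnS leq_eqVlt => /predU1P[|/xT]; last exact.
rewrite -e => /(pcan_inj pickleK)[/(g_inj ba' ba) -> /(g_inj ca' ca) -> ->].
by exists p.
Qed.

Lemma stage_exists phi a : rich phi a -> exists f, stage phi a f.
Proof.
move=> Hrich.
have /choice[f Hf] : forall n, exists f : nat -> bool, forall t (b : bool) N,
    exists i, [/\ N <= i,
      cyl a (odflt [::] (unpickle t)) (column_point phi n i) /\ obeys phi a n i & f i = b].
  move=> n; apply: split_infinite => t N; set p := odflt _ _.
  have [s0 [s0a Hs0]] := cyl_support a (size p).
  have [s [y [sa Hs]]] :=
    @obeying_refine phi a n n.+1 s0 (fun v => nth false p (g a v)) s0a.
  have [i [Ni /Hs[ip iO]]] := Hrich s y sa n N.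
  by exists i; split=> //; split=> // v va vp; apply: ip; exact: Hs0.
(* The mask enforces obedience wherever the value is true; the indices found by [Hf] obey already,
   so both values remain dense. *)
exists (fun n i => f n i && `[< obeys phi a n i >]); split.
  by move=> n i /andP[_ /asboolP].
move=> s y sa n b N; have [p Hp] := cyl_code a s y.
have [i [Ni [iq iO] fi]] := Hf n (pickle p) b N; rewrite pickleK /= in iq.
exists i; split=> //; first by rewrite fi; case: b {fi} => //=; apply/asboolP.
by move=> v vs; apply: Hp => //; exact: sa.
Qed.

Lemma stage_local phi psi a f : (forall v, lt v a -> phi v = psi v) ->
  stage phi a f -> stage psi a f.
Proof.
move=> e [f1 f2]; split.
  move=> n i /f1 O b c m ba ca /(O b c m ba ca)[p Hp]; exists p => v vb vp.
  by rewrite -Hp // /column_point e //; exact: lt_tr ba.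
move=> s y sa n b N; have [i [Ni fi Hi]] := f2 s y sa n b N.
by exists i; split=> // v vs; rewrite -Hi // /column_point e //; exact: sa.
Qed.

Lemma stages_exist : exists phi, forall a, stage phi a (phi a).
Proof.
have /choice[next Hnext] : forall x : (W -> nat -> nat -> bool) * W,
    exists f, (exists f', stage x.1 x.2 f') -> stage x.1 x.2 f.
  move=> [phi a]; have [[f Hf]|no] := pselect (exists f, stage phi a f).
    by exists f.
  by exists (fun _ _ => false) => /no.
(* [ext] fills the coordinates not below [a] with [false]; by [stage_local] they do not affect stage
   [a]. *)
pose ext a (rec : forall v, lt v a -> nat -> nat -> bool) v : nat -> nat -> bool :=
  if pselect (lt v a) is left va then rec v va else fun _ _ => false.
pose F a rec := next (ext a rec, a).
pose phi := Fix lt_wf (fun _ => nat -> nat -> bool) F.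
have phiE a : phi a = next (ext a (fun v _ => phi v), a).
  rewrite {1}/phi Fix_eq // => b f1 f2 f12; congr F.
  by apply: functional_extensionality_dep => v; apply: functional_extensionality_dep => vb.
exists phi; elim/(well_founded_ind lt_wf) => a IH.
have extE v : lt v a -> ext a (fun v _ => phi v) v = phi v.
  by rewrite /ext; case: pselect.
rewrite phiE; apply: (stage_local extE).
suff rich_ext : rich (ext a (fun v _ => phi v)) a.
  exact: (Hnext (ext a (fun v _ => phi v), a) (stage_exists rich_ext)).
apply: rich_stages => v va; rewrite extE //.
apply: stage_local (IH v va) => u uv.
by rewrite extE //; exact: lt_tr va.
Qed.

(** * Failure of NWD-separability *)

Section Generic.
Context {phi : W -> nat -> nat -> bool} (Hphi : forall a, stage phi a (phi a)).

Lemma generic_dense s y n N : exists i, N <= i /\ agree s (column_point phi n i) y.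
Proof.
have [a sa] := countable_bounded (In_countable s).
exact: (@rich_stages phi a (fun v _ => Hphi v)).
Qed.

Definition generic : set (cantor_cube W) := [set x | exists n i, x = column_point phi n i].

Lemma generic_countable : countable generic.
Proof.
apply: (@sub_countable _ _ _ [set: nat * nat]) => //.
apply: card_le_trans (card_image_le (fun ni : nat * nat => column_point phi ni.1 ni.2) _).
by apply: subset_card_le => x [n [i ->]]; exists (n, i).
Qed.

Lemma generic_pt n i : exists z : set_type generic, val z = column_point phi n i.
Proof.
have gi : generic (column_point phi n i) by exists n, i.
by exists (SigSub (mem_set gi)).
Qed.

Lemma generic_meets s y : [set z : set_type generic | agree s (val z) y] !=set0.
Proof.
have [i [_ iy]] := generic_dense s y 0 0.
by have [z zi] := generic_pt 0 i; exists z; rewrite /= zi.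
Qed.

Lemma dense_generic : dense generic.
Proof.
move=> O [x Ox] oO; have [s Hs] := open_cube_agree oO Ox.
have [z zx] := generic_meets s x.
by exists (val z); split; [exact: Hs|exact/set_mem/valP].
Qed.

Definition column n : set (set_type generic) :=
  [set z | exists i, val z = column_point phi n i].

Lemma dense_column n : dense (column n).
Proof.
move=> O [x Ox] oO; have [s Hs] := open_subspace_agree oO Ox.
have [i [_ ix]] := generic_dense s (val x) n 0.
have [z zi] := generic_pt n i.
by exists z; split; [apply: Hs; rewrite zi|exists i].
Qed.

Lemma nowhere_dense_agree (E : set (set_type generic)) s y : nowhere_dense E ->
  exists t y', agree s y' y /\
    forall z : set_type generic, agree (s ++ t) (val z) y' -> ~ E z.
Proof.
move=> /nowhere_denseP nE.
have [Q [oQ [x Qx] Qs QE]] := nE _ (open_agree generic s y) (generic_meets s y).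
have [t Ht] := open_subspace_agree oQ Qx.
exists t, (val x); split=> [|z /agree_app[_ /Ht Qz] Ez]; first exact: Qs.
have : set0 z by rewrite -QE.
by [].
Qed.

Section NonSelective.
Context (E : nat -> set (set_type generic)) (nE : forall n, nowhere_dense (E n)).

Definition forces t y n := forall z : set_type generic, agree t (val z) y -> ~ E n z.

(** Each finite condition below [a] is implied by one of countably many words, so choosing one
    refinement for every [n] and word involves only countably many coordinates. *)
Lemma close_step a : exists b, lt a b /\
  forall n s y, (forall v, List.In v s -> lt v a) ->
  exists t y', [/\ forall v, List.In v t -> lt v b, agree s y' y & forces t y' n].
Proof.
have /choice[S HS] := cyl_support a.
pose read p v := nth false p (g a v).
have /choice[T HT] : forall np : nat * seq bool, exists ty : seq W * (W -> bool),
    agree (S (size np.2)) ty.2 (read np.2) /\ forces (S (size np.2) ++ ty.1) ty.2 np.1.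
  move=> [n p] /=; have [t [y' [e Et]]] := nowhere_dense_agree (S (size p)) (read p) (nE n).
  by exists (t, y').
have [b Hb] : exists b, forall v, ([set a] `|` \bigcup_np
    [set v | List.In v (S (size np.2) ++ (T np).1)]) v -> lt v b.
  apply: countable_bounded; apply: countable_setU; first exact: countable1.
  by apply: bigcup_countable => // np _; exact: In_countable.
exists b; split; first by apply: Hb; left.
move=> n s y sa; have [p Hp] := cyl_code a s y.
have [e Et] := HT (n, p).
exists (S (size p) ++ (T (n, p)).1), (T (n, p)).2; split=> //.
  by move=> v vt; apply: Hb; right; exists (n, p).
move=> v vs; apply: Hp => //; last exact: sa.
by move=> u ua up; apply: e => /=; exact: (HS (size p)).2.
Qed.

(* Closing off: [b] is the supremum of an omega-sequence of [close_step]s. *)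
Lemma closure_point : exists b, forall n s y, (forall v, List.In v s -> lt v b) ->
  exists t y', [/\ forall v, List.In v t -> lt v b, agree s y' y & forces t y' n].
Proof.
have /choice[next Hnext] := close_step.
have [a0 _] := countable_bounded (countable0 W).
pose be := fix be k := if k is j.+1 then next (be j) else a0.
have be_lt j k v : j <= k -> lt v (be j) -> lt v (be k).
  elim: k => [|k IH]; first by rewrite leqn0 => /eqP ->.
  rewrite leq_eqVlt => /predU1P[->//|]; rewrite ltnS => jk vj.
  exact: lt_tr (IH jk vj) (Hnext (be k)).1.
pose B := \bigcup_k [set v | lt v (be k)].
have cB : countable B.
  by apply: bigcup_countable => // k _; case: HW.
have [c Bc] := countable_bounded cB.
(* [B] is closed downwards, so the least [b] outside it has exactly [B] as its set of
   predecessors. *)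
have [b [nBb bB]] : exists b, ~ B b /\ forall v, lt v b -> ~ ~ B v.
  by apply: (@lt_least (~` B)); exists c => /Bc; exact: lt_irr.
have Bb v : B v -> lt v b.
  move=> Bv; have [//|[e|bv]] := lt_total v b; first by case: nBb; rewrite -e.
  case: nBb; case: Bv => k _ vk; exists k => //; exact: lt_tr bv vk.
exists b => n s y sb.
have [k sk] : exists k, forall v, List.In v s -> lt v (be k).
  elim: s sb => [|v s IH] sb; first by exists 0.
  have [|k sk] := IH; first by move=> u us; apply: sb; right.
  have [j _ vj] : B v by apply: contrapT; apply: bB; apply: sb; left.
  exists (maxn j k) => u [<-|/sk uk]; first by apply: be_lt vj; exact: leq_maxl.
  by apply: be_lt uk; exact: leq_maxr.
have [t [y' [tb e Et]]] := (Hnext (be k)).2 n s y sk.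
by exists t, y'; split=> // v vt; apply: Bb; exists k.+1 => //; exact: tb.
Qed.

Hypothesis r_cofinal : forall D : nat -> set (seq bool),
  (forall n p w, D n p -> D n (p ++ w)) -> (forall n p, exists w, D n (p ++ w)) ->
  exists c m, forall n p, D n (p ++ r c m n p).

Lemma generic_avoids : exists a m0, forall n z,
  m0 <= n -> column n z -> val z a -> ~ E n z.
Proof.
have [b closed_b] := closure_point.
(* The choice of [b] makes each [D n] dense, so some strategy [(c, m)] always lands in it. Any [a]
   above [b] and [c] then works, from the column numbered by the code of that strategy at stage [a]
   on. *)
pose D n : set (seq bool) := [set p | forall z : set_type generic,
  cyl b p (val z) -> ~ E n z].
have [|n p|c [m Hcm]] := r_cofinal (D := D).
- by move=> n p w Dp z /cyl_cat; exact: Dp.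
- have [s [sb Hs]] := cyl_support b (size p).
  have [t [y [tb ys Et]]] := closed_b n s (fun v => nth false p (g b v)) sb.
  have [v vt vb vp|w Hw] := @cyl_refine b p t y; first by apply: ys; exact: Hs.
  by exists w => z zw; apply: Et => v vt; apply: Hw => //; exact: tb.
have [a Ha] := countable_bounded (In_countable [:: b; c]).
have ba : lt b a by apply: Ha; left.
have ca : lt c a by apply: Ha; right; left.
exists a, (pickle (g a b, g a c, m)) => n z mn [i zi].
rewrite zi => /(Hphi a).1/(_ b c m ba ca mn)[p]; rewrite -zi.
exact: Hcm.
Qed.

Lemma generic_not_dense : (forall n, E n `<=` column n) -> ~ dense (\bigcup_n E n).
Proof.
move=> EC dE; have [a [m0 Ha]] := generic_avoids.
have [s [y Hs]] : exists s y, forall z : set_type generic, agree s (val z) y ->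
    val z a /\ forall n, n < m0 -> ~ E n z.
  elim: m0 {Ha} => [|m [s [y Hs]]].
    by exists [:: a], (fun=> true) => z za; split=> //; rewrite za //; left.
  have [t [y' [y'y Et]]] := nowhere_dense_agree s y (nE m).
  exists (s ++ t), y' => z zt; have [|za zE] := Hs z.
    by move=> v vs; rewrite -y'y //; apply: zt; apply/In_cat; left.
  split=> // n; rewrite ltnS leq_eqVlt => /predU1P[->|/zE //]; exact: Et.
have [z [/Hs[za zE] [n _ Enz]]] :=
  dE _ (generic_meets s y) (open_agree generic s y).
have [mn|nm] := leqP m0 n; last exact: zE Enz.
exact: Ha mn (EC _ _ Enz) za Enz.
Qed.
End NonSelective.
End Generic.

(** * Countable cubes *)

(** An uncountable [K] receives [W] injectively by recursion, each value being chosen outside the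
    countable set of earlier ones. *)
Lemma countable_small (K : Type) : ~ ([set: W] #<= [set: K])%card -> countable [set: K].
Proof.
move=> WK; apply: contrapT => ncK; apply: WK.
have /choice[next Hnext] : forall S : set K, exists k, countable S -> ~ S k.
  move=> S; apply: contrapT => no; apply: ncK.
  have [cS|ncS] := pselect (countable S).
    apply: sub_countable cS; apply: subset_card_le => k _.
    by apply: contrapT => nSk; apply: no; exists k.
  (* The property asked of [k] is vacuous for an uncountable [S], so it can fail only if [K] is
     empty. *)
  have -> : [set: K] = set0 by apply/seteqP; split=> k // _; apply: no; exists k.
  exact: countable0.
pose F a (rec : forall v, lt v a -> K) := next [set k | exists v va, rec v va = k].
pose f := Fix lt_wf (fun _ => K) F.
have fE a : f a = next (f @` [set v | lt v a]).
  rewrite {1}/f Fix_eq => [|b f1 f2 f12].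
    by congr next; apply/seteqP; split=> [k [v [va <-]]|k [v va <-]]; exists v => //; exists va.
  congr F.
  by apply: functional_extensionality_dep => v; apply: functional_extensionality_dep => vb.
have f_new a v : lt v a -> f v <> f a.
  move=> va e; have : ~ (f @` [set v | lt v a]) (f a).
    rewrite [f a]fE; apply: Hnext.
    by apply: sub_countable (card_image_le _ _) _; case: HW => _ _ _ _; exact.
  by apply; exists v.
have f_inj : {in [set: W] &, injective f}.
  by move=> u v _ _ e; have [uv|[//|vu]] := lt_total u v;
    [case: (f_new _ _ uv)|case: (f_new _ _ vu)].
rewrite -(card_le_eql (inj_card_eq f_inj)); exact: card_leT.
Qed.
End Omega1.

(** * Discrete sets and D-separability *)

Lemma discrete_nowhere_dense (K : Type) (X : set (cantor_cube K)) (E : set (set_type X)) :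
  infinite_set [set: K] -> dense X -> discrete_subset E -> nowhere_dense E.
Proof.
move=> infK dX dE; apply/nowhere_denseP => O oO O0.
have [[x [Ox Ex]]|no] := pselect (exists x, O x /\ E x); last first.
  by exists O; split=> //; rewrite -subset0 => x [Ox Ex]; apply: no; exists x.
have [U [oU UE]] := dE x Ex.
have Ux : U x by have : [set x] x by []; rewrite -UE => -[].
have [s Hs] := open_subspace_agree (openI oU oO) (conj Ux Ox).
(* A basic neighbourhood isolating [x] in [E] mentions only [s]; flipping a coordinate [v] outside
   [s] gives an open set inside it without [x], nonempty since [X] is dense. *)
have [v nsv] : exists v, ~ List.In v s.
  apply: contrapT => no; apply: infK; apply: sub_finite_set (In_finite s) => v _.
  by apply: contrapT => nv; apply: no; exists v.
pose y k := if `[< k = v >] then ~~ val x v else val x k.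
have yv : y v = ~~ val x v by rewrite /y; case: asboolP.
exists [set z : set_type X | agree (v :: s) (val z) y].
have Qsub z : agree (v :: s) (val z) y -> U z /\ O z.
  move=> zy; apply: Hs => k ks; rewrite zy; last by right.
  by rewrite /y; case: asboolP => // e; case: nsv; rewrite -e.
split.
- exact: open_agree.
- have [|z [zy Xz]] := dX _ _ (open_agree_cube (v :: s) y); first by exists y.
  by exists (SigSub (mem_set Xz)).
- by move=> z /Qsub[].
- rewrite -subset0 => z [zy Ez]; have [Uz _] := Qsub _ zy.
  have : (U `&` E) z by [].
  rewrite UE => zx; have := zy v (or_introl erefl); rewrite yv zx.
  by case: (val x v).
Qed.

Lemma D_separable_NWD (K : Type) (X : set (cantor_cube K)) :
  infinite_set [set: K] -> dense X -> D_separable (set_type X) -> NWD_separable (set_type X).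
Proof.
move=> infK dX sepX D dD; have [E [HE dE]] := sepX D dD.
exists E; split=> // n; have [ED discE] := HE n; split=> //.
exact: discrete_nowhere_dense discE.
Qed.

Lemma list_InP (T : eqType) (k : T) s : reflect (List.In k s) (k \in s).
Proof.
elim: s => [|j s IH]; first by constructor.
rewrite inE eq_sym; apply: (iffP predU1P) => [[->|/IH]|[->|/IH]].
- by left.
- by right.
- by left.
- by right.
Qed.

(** Countably many coordinates give a countable base; a single point of [D n] in the [n]th basic
    set, when that is nonempty, serves as a discrete [E n]. *)
Lemma countable_cube_D_separable (K : Type) (X : set (cantor_cube K)) :
  countable [set: K] -> D_separable (set_type X).
Proof.
move=> /Pcountable[K' eK]; move: X; rewrite {}eK => X D dD.
pose basic p : set (set_type X) :=
  [set z | agree (map fst p) (val z) (fun k : K' => (k, true) \in p)].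
have /choice[E HE] : forall n, exists E : set (set_type X),
    [/\ E `<=` D n, discrete_subset E &
     basic (odflt [::] (unpickle n)) !=set0 ->
     basic (odflt [::] (unpickle n)) `&` E !=set0].
  move=> n; have [B0|nB0] := pselect (basic (odflt [::] (unpickle n)) !=set0).
  2: by exists set0; split.
  have [x [Bx Dx]] := dD n _ B0 (open_agree _ _ _).
  exists [set x]; split=> [_ -> //|_ -> |_]; last by exists x.
  by exists setT; rewrite setTI; split=> //; exact: openT.
exists E; split=> [n|O [x Ox] oO]; first by have [] := HE n.
have [s Hs] := open_subspace_agree oO Ox.
pose p := [seq (k, val x k) | k <- s].
have [_ _] := HE (pickle p); rewrite pickleK /=.
have ps : map fst p = s by rewrite -map_comp map_id.
have pE k : List.In k s -> ((k, true) \in p) = val x k.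
  move=> /list_InP ks; apply/idP/idP => [/mapP[j _ [-> xj]]|xk]; first exact: (esym xj).
  by apply/mapP; exists k => //; congr pair; exact: (esym xk).
case=> [|z [Bz Ez]]; first by exists x => k; rewrite ps => /pE.
exists z; split; last by exists (pickle p).
by apply: Hs => k ks; rewrite Bz ?ps // pE.
Qed.

Theorem theorem4p11 (R : realType) (W : Type) (ltW : W -> W -> Prop) :
  is_omega1 ltW ->
  @cof_meager_is (R : topologicalType) W ->
  (exists X : set (cantor_cube W),
      countable X /\ dense X /\ ~ NWD_separable (set_type X)) /\
  cds_is W.
Proof.
move=> HW /strategies_cofinal[r Hr].
have [g g_inj] := below_injection HW.
have [phi Hphi] := stages_exist HW g_inj r.
have nsep : ~ NWD_separable (set_type (@generic W phi)).
  move=> /(_ (@column W phi))[|E [HE dE]]; first exact: dense_column Hphi.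
  exact: (generic_not_dense HW g_inj Hphi (fun n => (HE n).2) Hr (fun n => (HE n).1)).
have cX := @generic_countable W phi.
have dX := dense_generic HW Hphi.
split; first by exists (generic (phi := phi)).
(* Minimality: an exponent into which [W] does not embed is countable, and its cube has only
   D-separable subspaces. *)
split=> [|K _ /(countable_small HW) cK [X [_]]].
  exists (generic (phi := phi)); split=> // /(D_separable_NWD _ dX) sep.
  apply: nsep; apply: sep => /finite_set_countable.
  by case: HW.
by apply; exact: countable_cube_D_separable.
Qed.
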